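(* Let $X$ be a $T_1$ space with at least two points, let $\mathcal{B}$ be a normal base for the closed sets of $X$, and let $\delta_b$ be the Wallman-Frink proximity associated with $\mathcal{B}$. Then there is a homeomorphism $f$ from the $T_1$ compactification $T_bX$ of $(X,\delta_b)$ onto the Wallman-Frink compactification $bX$ which fixes $X$ pointwise, i.e. $f(\Pi(\mu_x))=\mu_x\cap\mathcal{B}$ for every $x\in X$, where $\mu_x=\{A\subseteq X : x\in A\}$.
   Context: A family $\mathcal{B}$ of closed subsets of $X$ is a base for the closed sets if every closed set is the intersection of a nonempty subfamily of $\mathcal{B}$ (so $X\in\mathcal{B}$). A *normal base* is a base $\mathcal{B}$ for the closed sets such that (1) $\mathcal{B}$ is a network: if $x\in G$ with $G$ open, there is $B\in\mathcal{B}$ with $x\in B\subseteq G$; and (2) $\mathcal{B}$ is a ring of sets: closed under finite unions and finite intersections. The *Wallman-Frink proximity* $\delta_b$ is the relation on subsets of $X$ such that $A\,\delta_b\,B$ fails iff there are $F_1,F_2\in\mathcal{B}$ with $A\subseteq F_1$, $B\subseteq F_2$, $F_1\cap F_2=\emptyset$. For families $\gamma,\gamma'$ of subsets of $X$, $\gamma\,\delta_b\,\gamma'$ means $A\,\delta_b\,B$ for all $A\in\gamma$, $B\in\gamma'$. A *filterbase* is a nonempty family of nonempty sets such that the intersection of any two members contains a member. A *$b$-filter* is a filterbase $\mathcal{F}\subseteq\mathcal{B}$ such that $B\in\mathcal{F}$ and $B\subseteq F\in\mathcal{B}$ imply $F\in\mathcal{F}$; a *$b$-ultrafilter* is a maximal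 $b$-filter. An ultrafilter $\mu$ on $X$ is *of type $b$* if $\mu\cap\mathcal{B}$ is a $b$-ultrafilter. For an ultrafilter $\alpha$, $\Pi(\alpha)=\bigcup\{\upsilon : \upsilon \text{ is an ultrafilter on } X \text{ and } \upsilon\,\delta_b\,\alpha\}$. $T_bX$ is the set $\{\Pi(\alpha) : \alpha \text{ is an ultrafilter of type } b\}$ with the topology having the sets $\{\sigma\in T_bX : B\in\sigma\}$, $B\in\mathcal{B}$, as a base for its closed sets; $X$ is embedded in it by $x\mapsto\Pi(\mu_x)$. $bX$ is the set of all $b$-ultrafilters with the topology having the sets $\{\varphi\in bX : B\in\varphi\}$, $B\in\mathcal{B}$, as a base for its closed sets; it is a compact $T_1$ space in which $X$ is densely embedded by $x\mapsto\mu_x\cap\mathcal{B}$. *)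

(* Defs.v *)
From HB Require Import structures.
From mathcomp Require Import all_boot all_order finmap all_classical.
From mathcomp Require Import topology.

Set Implicit Arguments.
Unset Strict Implicit.
Unset Printing Implicit Defensive.

Local Open Scope classical_set_scope.

Definition closed_base (T : topologicalType) (B : set (set T)) : Prop :=
  B `<=` closed /\
  forall C : set T, closed C ->
    exists S : set (set T), [/\ S !=set0, S `<=` B & C = \bigcap_(A in S) A].

Definition homeomorphism (S T : topologicalType) (f : S -> T) : Prop :=
  continuous f /\
  exists g : T -> S, [/\ cancel f g, cancel g f & continuous g].

(* Closure under binary unions and intersections is enough for a ring of sets:
   [set0] and [setT] need not be required, see [normal_base_setT] and
   [normal_base_set0]. *)
Record normal_base (X : topologicalType) (B : set (set X)) : Prop := NormalBase {
  normal_base_closed_base : closed_base B;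
  normal_base_network : forall (x : X) (G : set X), open G -> G x ->
    exists C : set X, [/\ B C, C x & C `<=` G];
  normal_base_setU : forall A C : set X, B A -> B C -> B (A `|` C);
  normal_base_setI : forall A C : set X, B A -> B C -> B (A `&` C) }.

Section WallmanFrink.
Context (X : topologicalType) (B : set (set X)).
Implicit Types (A C : set X) (F G : set (set X)).

Definition wf_prox A C : Prop :=
  ~ exists F1 F2 : set X,
      [/\ B F1, B F2, A `<=` F1, C `<=` F2 & F1 `&` F2 = set0].

Definition wf_prox_family F G : Prop :=
  forall A C, F A -> G C -> wf_prox A C.

Definition filterbase F : Prop :=
  [/\ F !=set0, (forall A, F A -> A !=set0) &
      forall A C, F A -> F C -> exists2 D, F D & D `<=` A `&` C].

Definition b_filter F : Prop :=
  [/\ filterbase F, F `<=` B & forall A C, F A -> A `<=` C -> B C -> F C].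

Definition b_ultrafilter F : Prop :=
  b_filter F /\ forall G, b_filter G -> F `<=` G -> G = F.

Definition type_b (mu : set (set X)) : Prop :=
  UltraFilter mu /\ b_ultrafilter (mu `&` B).

Definition Pi (alpha : set (set X)) : set (set X) :=
  \bigcup_(u in [set u | UltraFilter u /\ wf_prox_family u alpha]) u.

Definition mu (x : X) : set (set X) := [set A | A x].

End WallmanFrink.

(* The points of both compactifications are families of subsets of [X], and the
   basic closed sets are the [{s | A \in s}] with [A] in [B].  The topology is
   the one having their complements as an open subbase; that the basic closed
   sets then form a base for the closed sets, and not merely a subbase, is
   [TbX_closed_base] and [bX_closed_base].  The argument [B] of [family_space]
   only serves to determine the topology. *)
Record family_space (X : Type) (B : set (set X)) (P : set (set (set X))) :=
  FamilySpace { family_val : set (set X); family_valP : P family_val }.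

Section FamilySpace.
Context (X : Type) (B : set (set X)) (P : set (set (set X))).

Definition basic_closed (A : set X) : set (family_space B P) :=
  [set s | family_val s A].

HB.instance Definition _ := gen_eqMixin (family_space B P).
HB.instance Definition _ := gen_choiceMixin (family_space B P).
HB.instance Definition _ := isSubBaseTopological.Build (family_space B P)
  B (fun A => ~` basic_closed A).

End FamilySpace.

Definition TbX (X : topologicalType) (B : set (set X)) : Type :=
  family_space B (Pi B @` type_b B).

Definition bX (X : topologicalType) (B : set (set X)) : Type :=
  family_space B (b_ultrafilter B).

Section Facts.
Context (X : topologicalType) (B : set (set X)).
Implicit Types (A C : set X) (F G : set (set X)).
Hypothesis nB : normal_base B.

Lemma normal_base_setT : B setT.
Proof.
have [_ /(_ _ closedT)[S [[A SA] SB TE]]] := normal_base_closed_base nB.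
suff -> : setT = A by exact: SB.
by apply/seteqP; split=> // x; rewrite TE; exact.
Qed.

Lemma normal_base_closed A : B A -> closed A.
Proof. by case: (normal_base_closed_base nB) => + _; exact. Qed.

Lemma normal_base_separate x A : B A -> ~ A x ->
  exists C, [/\ B C, C x & C `&` A = set0].
Proof.
move=> BA nAx.
have oA : open (~` A) by rewrite openC; exact: normal_base_closed.
have [C [BC Cx CA]] := normal_base_network nB oA nAx.
by exists C; split=> //; apply/disjoints_subset.
Qed.

Lemma normal_base_set0 :
  accessible_space X -> (exists x y : X, x <> y) -> B set0.
Proof.
move=> T1 [x [y /eqP xy]].
have [U [oU /set_mem Ux /set_mem nUy]] := T1 x y xy.
have [A [BA Ax AU]] := normal_base_network nB oU Ux.
have [C [BC Cy CA]] := normal_base_separate BA (fun Ay => nUy (AU _ Ay)).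
by rewrite -CA; exact: normal_base_setI.
Qed.

Lemma mu_ultra x : UltraFilter (@mu X x).
Proof.
have -> : mu x = principal_filter x.
  by apply/funext => A; apply/propext; rewrite principal_filterP.
exact: principal_filter_ultra.
Qed.

Lemma mu_b_ultrafilter x : b_ultrafilter B (mu x `&` B).
Proof.
split=> [|G [[_ G0 GI] GB _] muG].
  split=> [|A []//|A C [Ax _] sAC BC]; last by split=> //; exact: sAC.
  split=> [|A [Ax _]|A C [Ax BA] [Cx BC]]; last 1 first.
  - by exists (A `&` C) => //; split=> //; exact: normal_base_setI.
  - by exists setT; split=> //; exact: normal_base_setT.
  - by exists x.
apply/seteqP; split=> // A GA; split; last exact: GB.
apply: contrapT => nAx.
have [C [BC Cx CA]] := normal_base_separate (GB _ GA) nAx.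
have [D GD] := GI _ _ (muG _ (conj Cx BC)) GA.
by rewrite CA subset0 => D0; have := G0 _ GD; rewrite D0 => -[].
Qed.

Lemma mu_type_b x : type_b B (mu x).
Proof. by split; [exact: mu_ultra|exact: mu_b_ultrafilter]. Qed.

Definition TbX_point (x : X) : TbX B :=
  FamilySpace B (imageP (Pi B) (mu_type_b x)).

Definition bX_point (x : X) : bX B :=
  FamilySpace B (mu_b_ultrafilter x).

Lemma TbX_pointE x : family_val (TbX_point x) = Pi B (mu x).
Proof. by []. Qed.

Lemma bX_pointE x : family_val (bX_point x) = mu x `&` B.
Proof. by []. Qed.

Lemma basic_closedP P A : B A -> closed (@basic_closed X B P A).
Proof.
move=> BA; rewrite -openC.
exists [set ~` @basic_closed X B P A]; last by rewrite bigcup_set1.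
move=> _ ->; exists [fset A]%fset.
  by move=> C; rewrite in_fset1 => /eqP ->; exact/mem_set.
apply/seteqP; split=> [s|s nAs C /=]; last by rewrite in_fset1 => /eqP ->.
by apply; rewrite /= in_fset1.
Qed.

Lemma open_family_space P (U : set (family_space B P)) s : open U -> U s ->
  exists l : seq (set X), [/\ forall A, A \in l -> B A,
    forall A, A \in l -> ~ basic_closed A s &
    forall t, (forall A, A \in l -> ~ basic_closed A t) -> U t].
Proof.
move=> [D' D'I <-] [V D'V Vs]; have [l lB lV] := D'I _ D'V.
change (V s) in Vs; exists (enum_fset l); split=> [A Al|A Al|t lt].
- by apply/set_mem; exact: lB.
- by move: Vs; rewrite -lV; exact.
- by exists V => //; change (V t); rewrite -lV => A /lt.
Qed.

Lemma family_space_closed_base (P : set (set (set X))) :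
  B set0 ->
  (forall s, P s -> s setT /\ ~ s set0) ->
  (forall s A C, P s -> B A -> B C -> s (A `|` C) <-> s A \/ s C) ->
  closed_base [set @basic_closed X B P A | A in B].
Proof.
move=> B0 PT PU.
have Pval := @family_valP X B P.
split=> [_ [A BA <-]|C clC]; first exact: basic_closedP.
pose S := [set A | B A /\ C `<=` @basic_closed X B P A].
exists (@basic_closed X B P @` S); split.
- exists (basic_closed setT); exists setT => //; split.
    exact: normal_base_setT.
  by move=> s _; exact: (PT _ (Pval s)).1.
- by move=> _ [A [BA _] <-]; exists A.
apply/seteqP; split=> [s Cs _ [A [_ CA] <-]|s Ss]; first exact: CA.
apply: contrapT => nCs.
have fin_union (l : seq (set X)) : (forall A, A \in l -> B A) ->
    exists2 U, B U &
      forall t, @basic_closed X B P U t <->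
        exists2 A, A \in l & @basic_closed X B P A t.
  elim: l => [_|A l IHl lB].
    by exists set0 => // t; split=> [/(PT _ (Pval t)).2//|[]].
  have [|U BU UE] := IHl.
    by move=> D Dl; apply: lB; rewrite inE Dl orbT.
  have BA : B A by apply: lB; rewrite mem_head.
  exists (A `|` U); first exact: normal_base_setU.
  move=> t; apply: (iff_trans (PU _ _ _ (Pval t) BA BU)); split.
    move=> [At|/UE[D Dl Dt]]; first by exists A => //; rewrite mem_head.
    by exists D => //; rewrite inE Dl orbT.
  move=> [D]; rewrite inE => /orP[/eqP -> Dt|Dl Dt]; first by left.
  by right; apply/UE; exists D.
have oC : open (~` C) by rewrite openC.
have [l [lB ls lC]] := open_family_space oC nCs.
have [U BU UE] := fin_union l lB.
have : basic_closed U s.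
  apply: (Ss); exists U => //; split=> // t Ct; apply: contrapT => nUt.
  by apply: (lC t) => // A Al At; apply: nUt; apply/UE; exists A.
by move=> /UE[A Al]; exact: ls.
Qed.

Lemma ultra_setU (u : set (set X)) A C :
  UltraFilter u -> u (A `|` C) -> u A \/ u C.
Proof.
move=> uu uAC; have [|nA] := in_ultra_setVsetC A uu; [by left|right].
apply: (@filterS _ u _ ((A `|` C) `&` ~` A)); last exact: filterI.
by move=> x [[]].
Qed.

Lemma b_ultrafilter_setU F A C : b_ultrafilter B F -> B A -> B C ->
  F (A `|` C) <-> F A \/ F C.
Proof.
move=> [[[F0 Fne FI] FB Fup] Fmax] BA BC; split; last first.
  have BU := normal_base_setU nB BA BC.
  by move=> [FA|FC]; [apply: (Fup A)|apply: (Fup C)].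
have meet D : B D -> (forall E, F E -> E `&` D !=set0) -> F D.
  move=> BD DF.
  suff <- : [set G | B G /\ exists2 E, F E & E `&` D `<=` G] = F.
    by split=> //; have [E FE] := F0; exists E => // x [].
  apply: Fmax; last first.
    by move=> E FE; split; [exact: FB|exists E => // x []].
  split=> [|E []//|E G [BE [H FH HE]] EG BG]; last first.
    by split=> //; exists H => //; exact: subset_trans EG.
  split.
  - by exists D; split=> //; have [E FE] := F0; exists E => // x [].
  - by move=> E [_ [H FH HE]]; have [x Hx] := DF _ FH; exists x; exact: HE.
  move=> E G [BE [H FH HE]] [BG [K FK KG]].
  exists (E `&` G) => //; split; first exact: normal_base_setI.
  have [L FL LHK] := FI _ _ FH FK; exists L => // x [/LHK[Hx Kx] Dx].
  by split; [exact: HE|exact: KG].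
move=> FAC; apply: contrapT => /not_orP[nA nC].
have miss D : B D -> ~ F D -> exists2 E, F E & E `&` D = set0.
  move=> BD nD; apply: contrapT => nE; apply: nD; apply: meet => // E FE.
  by apply/set0P/eqP => E0; apply: nE; exists E.
have [E FE EA] := miss _ BA nA; have [G FG GC] := miss _ BC nC.
have [H FH HEG] := FI _ _ FE FG; have [K FK KH] := FI _ _ FH FAC.
have [x /KH[/HEG[Ex Gx] [Ax|Cx]]] := Fne _ FK.
  by have : set0 x by rewrite -EA.
by have : set0 x by rewrite -GC.
Qed.

Lemma TbX_closed_base :
  accessible_space X -> (exists x y : X, x <> y) ->
  closed_base [set [set s : TbX B | family_val s A] | A in B].
Proof.
move=> T1 X2; apply: family_space_closed_base.
- exact: normal_base_set0.
- move=> _ [a [ua _] <-]; split; last by move=> [u [uu _] /filter_not_empty].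
  have [G [uG aG]] : exists G, UltraFilter G /\ wf_prox_family B G a.
    exists a; split=> // A C aA aC [F1 [F2 [_ _ AF CF F0]]].
    apply: (@filter_not_empty _ a); rewrite -F0.
    by apply: filterI; [exact: filterS aA|exact: filterS aC].
  by exists G => //; exact: filterT.
move=> _ A C [a _ <-] BA BC; split.
  by move=> [u [uu ua] /(ultra_setU uu)[uA|uC]]; [left|right]; exists u.
by move=> [] [u [uu ua] uA]; exists u => //; apply: filterS uA => x;
  [left|right].
Qed.

Lemma bX_closed_base :
  accessible_space X -> (exists x y : X, x <> y) ->
  closed_base [set [set s : bX B | family_val s A] | A in B].
Proof.
move=> T1 X2; apply: family_space_closed_base.
- exact: normal_base_set0.
- move=> F [[[[A FA] Fne _] FB Fup] _]; split; last by move=> /Fne[x].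
  by apply: (Fup A) => //; exact: normal_base_setT.
by move=> F A C FF BA BC; exact: b_ultrafilter_setU.
Qed.

End Facts.

(* Main.v *)
(* If [a] is of type b, maximality of [a `&` B] makes an ultrafilter [u] near
   [a] exactly when [u `&` B `<=` a `&` B].  Hence [Pi B a] is determined by
   [a `&` B], and [Pi B a `&` B = a `&` B], so that tracing on [B] is the
   homeomorphism.  It is onto because an ultrafilter containing a b-ultrafilter
   has that b-ultrafilter as its trace. *)
Require Import Defs.
From mathcomp Require Import all_boot all_order all_classical.
From mathcomp Require Import topology.

Set Implicit Arguments.
Unset Strict Implicit.
Unset Printing Implicit Defensive.

Local Open Scope classical_set_scope.

Lemma closed_base_continuous (S T : topologicalType) (K : set (set T))
    (f : S -> T) :
  closed_base K -> (forall A, K A -> closed (f @^-1` A)) -> continuous f.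
Proof.
move=> [_ KE] fK; apply/continuous_closedP => C /KE[L [_ LK ->]].
by rewrite preimage_bigcap; apply: closed_bigI => A /LK; exact: fK.
Qed.

Lemma filterbase_ultra (T : topologicalType) (F : set (set T)) :
  filterbase F -> exists2 u, UltraFilter u & F `<=` u.
Proof.
move=> [[A0 FA0] Fne FI].
have FF : ProperFilter (filter_from F id).
  apply: filter_from_proper => //; apply: filter_from_filter; first by exists A0.
  by move=> A C FA FC; exact: FI.
have [u [uu Fu]] := ultraFilterLemma FF.
by exists u => // A FA; apply: Fu; exists A.
Qed.

Lemma family_val_inj (X : Type) (B : set (set X)) P :
  injective (@family_val X B P).
Proof.
move=> [s Ps] [t Pt] /= st; subst t.
by rewrite (Prop_irrelevance Ps Pt).
Qed.

Section Trace.
Context (X : topologicalType) (B : set (set X)) (nB : normal_base B).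
Implicit Types (A C : set X) (F u a : set (set X)).

Lemma ultra_trace_b_filter u : UltraFilter u -> b_filter B (u `&` B).
Proof.
move=> uu; split=> [|A []//|A C [uA _] AC BC]; last first.
  by split=> //; exact: filterS uA.
split=> [|A [uA _]|A C [uA BA] [uC BC]].
- by exists setT; split; [exact: filterT|exact: normal_base_setT].
- exact: filter_ex uA.
- exists (A `&` C) => //; split; first exact: filterI.
  exact: normal_base_setI.
Qed.

Lemma ultra_trace F u : b_ultrafilter B F -> UltraFilter u -> F `<=` u ->
  u `&` B = F.
Proof.
move=> [[_ FB _] Fmax] uu Fu; apply: Fmax; first exact: ultra_trace_b_filter.
by move=> A FA; split; [exact: Fu|exact: FB].
Qed.

(** The traces of [A] on the members of [F] form a filterbase. An ultrafilter above it contains both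
    [A] and [F], and by maximality its own trace on [B] is [F]. *)
Lemma b_ultrafilter_meets F A : b_ultrafilter B F -> B A ->
  (forall C, F C -> A `&` C !=set0) -> F A.
Proof.
move=> bF BA AF; have [[[[C0 FC0] _ FI] _ _] _] := bF.
have [|u uu Gu] := @filterbase_ultra _ [set A `&` C | C in F].
  split=> [|_ [C /AF ? <-]//|_ _ [C FC <-] [D FD <-]].
    by exists (A `&` C0), C0.
  have [E FE ECD] := FI _ _ FC FD.
  exists (A `&` E); first by exists E.
  by move=> x [Ax /ECD[Cx Dx]].
rewrite -(ultra_trace bF uu) => [|C FC].
  (* Any member of [F] would do for [C0]: it only serves to put the superset [A] in [u]. *)
  by split=> //; apply: (@filterS _ u _ (A `&` C0)) => [x []//|]; apply: Gu; exists C0.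
by apply: (@filterS _ u _ (A `&` C)) => [x []//|]; apply: Gu; exists C.
Qed.

Lemma wf_prox_family_trace u a : UltraFilter u -> type_b B a ->
  wf_prox_family B u a <-> u `&` B `<=` a `&` B.
Proof.
move=> uu [ua ba]; split=> [pua A [uA BA]|sua A C uA aC].
  apply: (b_ultrafilter_meets ba BA) => C [aC BC].
  (* If they were disjoint, [A] and [C], both in [B], would themselves be the separating pair. *)
  by apply/set0P/eqP => AC0; apply: (pua A C uA aC); exists A, C; split.
(* A separating pair is impossible: [F1] lies in [u], hence in [a], while [F2] lies in [a] too. *)
move=> [F1 [F2 [B1 B2 AF1 CF2 F0]]].
apply: (@filter_not_empty _ a); rewrite -F0; apply: filterI.
  by have [] // : (a `&` B) F1; apply: sua; split=> //; exact: filterS uA.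
exact: filterS aC.
Qed.

(** This is [Pi] expressed through the trace alone, so that the inverse map is defined from a
    b-ultrafilter without choosing an ultrafilter above it. *)
Definition near_set F : set (set X) :=
  \bigcup_(u in [set u | UltraFilter u /\ u `&` B `<=` F]) u.

Lemma Pi_near_set a : type_b B a -> Pi B a = near_set (a `&` B).
Proof.
move=> ta; apply: eq_bigcupl.
by split=> u [uu /(wf_prox_family_trace uu ta)].
Qed.

(** Each ultrafilter in the union has its trace inside [F], and one that contains [F] has trace
    exactly [F], so it belongs to the union and supplies all of [F]. *)
Lemma near_set_trace F : b_ultrafilter B F -> near_set F `&` B = F.
Proof.
move=> bF; apply/seteqP; split=> [A [[u [_ uF] uA] BA]|A FA]; first exact: uF.
have [[FF FB _] _] := bF; split; last exact: FB.
have [u uu Fu] := filterbase_ultra FF.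
by exists u; [split; rewrite ?(ultra_trace bF)|exact: Fu].
Qed.

Lemma Pi_trace a : type_b B a -> Pi B a `&` B = a `&` B.
Proof. by move=> ta; rewrite Pi_near_set// near_set_trace//; case: ta. Qed.

Lemma b_ultrafilter_type_b F : b_ultrafilter B F ->
  exists2 a, type_b B a & a `&` B = F.
Proof.
move=> bF; have [[FF _ _] _] := bF.
have [a ua Fa] := filterbase_ultra FF; have aF := ultra_trace bF ua Fa.
by exists a => //; split=> //; rewrite aF.
Qed.

Lemma TbX_trace_b_ultrafilter (s : TbX B) :
  b_ultrafilter B (family_val s `&` B).
Proof. by have [a ta <-] := family_valP s; rewrite Pi_trace//; case: ta. Qed.

Lemma near_set_TbX F : b_ultrafilter B F -> (Pi B @` type_b B) (near_set F).
Proof.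
by move=> /b_ultrafilter_type_b[a ta <-]; exists a => //; rewrite Pi_near_set.
Qed.

Definition TbX_to_bX (s : TbX B) : bX B :=
  FamilySpace B (TbX_trace_b_ultrafilter s).

Definition bX_to_TbX (t : bX B) : TbX B :=
  FamilySpace B (near_set_TbX (family_valP t)).

Lemma TbX_to_bXK : cancel TbX_to_bX bX_to_TbX.
Proof.
case=> s Ps; apply: family_val_inj => /=; have [a ta <-] := Ps.
by rewrite Pi_trace// Pi_near_set.
Qed.

Lemma bX_to_TbXK : cancel bX_to_TbX TbX_to_bX.
Proof. by case=> F bF; apply: family_val_inj; exact: near_set_trace. Qed.

Hypotheses (T1X : accessible_space X) (X2 : exists x y : X, x <> y).

(** Continuity is tested on the basic closed sets; they form a closed base because [T1X] and [X2]
    put the empty set in [B]. For [A] in [B], tracing on [B] does not affect membership of [A], so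
    basic closed sets pull back to basic closed sets. *)
Lemma TbX_to_bX_continuous : continuous TbX_to_bX.
Proof.
apply: (closed_base_continuous (bX_closed_base nB T1X X2)) => _ [A BA <-].
rewrite (_ : _ @^-1` _ = @basic_closed X B _ A); first exact: basic_closedP.
by apply/seteqP; split=> [s []|].
Qed.

Lemma bX_to_TbX_continuous : continuous bX_to_TbX.
Proof.
apply: (closed_base_continuous (TbX_closed_base nB T1X X2)) => _ [A BA <-].
rewrite (_ : _ @^-1` _ = @basic_closed X B _ A); first exact: basic_closedP.
(* On members of [B], a b-ultrafilter agrees with its [near_set]. *)
apply/seteqP; split=> t /=; rewrite /basic_closed /=.
  by rewrite -{2}(near_set_trace (family_valP t)); split.
by rewrite -{1}(near_set_trace (family_valP t)) => -[].
Qed.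

End Trace.

Theorem theorem15 (X : topologicalType) (B : set (set X))
  (T1X : accessible_space X) (X2 : exists x y : X, x <> y)
  (nB : normal_base B) :
  exists f : TbX B -> bX B,
    homeomorphism f /\ forall x : X, f (TbX_point nB x) = bX_point nB x.
Proof.
exists (TbX_to_bX nB); split=> [|x].
  split; first exact: TbX_to_bX_continuous.
  exists (bX_to_TbX nB); split.
  - exact: TbX_to_bXK.
  - exact: bX_to_TbXK.
  - exact: bX_to_TbX_continuous.
(* Points are fixed because [mu x] is of type b, so [Pi B (mu x)] and [mu x] have the same trace. *)
by apply: family_val_inj; rewrite /= Pi_trace//; exact: mu_type_b.
Qed.
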